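(* Let $V$ be a vincular pattern of length $k$ with at least one bond, and let $\tau$ be a permutation. Then $\mathrm{Box}(\tau)$ and $V$ are coincident if and only if the pair $(\mathrm{Box}(\tau),V)$ occurs in the following list: for $k=2$: $(\mathrm{Box}(12),\underline{12})$, $(\mathrm{Box}(21),\underline{21})$; for $k=3$: $(\mathrm{Box}(132),\underline{13}2)$, $(\mathrm{Box}(213),2\underline{13})$, $(\mathrm{Box}(231),2\underline{31})$, $(\mathrm{Box}(312),\underline{31}2)$; for $k=4$: $(\mathrm{Box}(2413),2\underline{41}3)$, $(\mathrm{Box}(3142),3\underline{14}2)$. In particular, there is no such boxed--vincular coincidence in length $k\ge5$.
   Context: $\mathfrak S_n$ is the set of permutations $\pi=\pi_1\cdots\pi_n$ of $\{1,\dots,n\}$. For $\tau\in\mathfrak S_k$, an occurrence of the boxed pattern $\mathrm{Box}(\tau)$ in $\pi\in\mathfrak S_n$ is a choice of positions $i_1<\cdots<i_k$ such that $\pi_{i_1}\cdots\pi_{i_k}$ is order-isomorphic to $\tau$ and there is no index $j\notin\{i_1,\dots,i_k\}$ with $i_1<j<i_k$ and $\min_r \pi_{i_r}<\pi_j<\max_r\pi_{i_r}$. A vincular pattern of length $k$ is a pair $(\sigma,X)$ with $\sigma\in\mathfrak S_k$ and $X\subseteq\{1,\dots,k-1\}$ (the elements of $X$ are the bonds); an occurrence of it in $\pi$ is a choice of positions $i_1<\cdots<i_k$ with $\pi_{i_1}\cdots\pi_{i_k}$ order-isomorphic to $\sigma$ and $i_{x+1}=i_x+1$ for every $x\in X$.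 Bonds are indicated by underlining: e.g. $2\underline{41}3=(2413,\{2\})$, $\underline{13}2=(132,\{1\})$, $2\underline{13}=(213,\{2\})$. $\mathrm{Av}_n(P)$ is the set of permutations in $\mathfrak S_n$ with no occurrence of $P$. Patterns $P$ and $Q$ are coincident if $\mathrm{Av}_n(P)=\mathrm{Av}_n(Q)$ for every $n\ge0$. *)

(* Defs.v *)
From mathcomp Require Import all_boot all_fingroup.

Set Implicit Arguments.
Unset Strict Implicit.
Unset Printing Implicit Defensive.

(* Permutations are elements of 'S_n = {perm 'I_n}, so positions and values
   range over 0, ..., n-1.  A choice of positions i_1 < ... < i_k is a strictly
   increasing finite function f : 'I_k -> 'I_n. *)

Definition increasing (k n : nat) (f : {ffun 'I_k -> 'I_n}) : bool :=
  [forall a : 'I_k, forall b : 'I_k, (a < b) ==> (f a < f b)].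

Definition order_isomorphic (k n : nat) (tau : 'S_k) (pi : 'S_n)
    (f : {ffun 'I_k -> 'I_n}) : bool :=
  [forall a : 'I_k, forall b : 'I_k,
     (pi (f a) < pi (f b)) == (tau a < tau b)].

(* i_1 < j < i_k says that some chosen position is to the left of j and some
   chosen position is to its right; min_r pi_(i_r) < pi_j < max_r pi_(i_r) says
   the same of values.  These forms also make sense for k = 0. *)
Definition in_box (k n : nat) (pi : 'S_n) (f : {ffun 'I_k -> 'I_n})
    (j : 'I_n) : bool :=
  [&& [exists r, f r < j], [exists r, j < f r],
      [exists r, pi (f r) < pi j] & [exists r, pi j < pi (f r)]].

Definition box_occurrence (k n : nat) (tau : 'S_k) (pi : 'S_n)
    (f : {ffun 'I_k -> 'I_n}) : bool :=
  [&& increasing f, order_isomorphic tau pi f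
    & ~~ [exists j : 'I_n, (j \notin codom f) && in_box pi f j]].

(* The element x of X : {set 'I_k.-1} stands for the bond x + 1 of
   {1, ..., k - 1}: it joins the 0-based pattern positions x and x + 1. *)
Definition vincular_occurrence (k n : nat) (sigma : 'S_k) (X : {set 'I_k.-1})
    (pi : 'S_n) (f : {ffun 'I_k -> 'I_n}) : bool :=
  [&& increasing f, order_isomorphic sigma pi f
    & [forall x in X, forall a : 'I_k, forall b : 'I_k,
         (a == x :> nat) ==> (b == x.+1 :> nat) ==> (f b == (f a).+1 :> nat)]].

Inductive pattern : Type :=
  | Box (k : nat) (tau : 'S_k)
  | Vincular (k : nat) (sigma : 'S_k) (X : {set 'I_k.-1}).

Definition occurs (P : pattern) (n : nat) (pi : 'S_n) : bool :=
  match P with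
  | @Box k tau => [exists f : {ffun 'I_k -> 'I_n}, box_occurrence tau pi f]
  | @Vincular k sigma X =>
      [exists f : {ffun 'I_k -> 'I_n}, vincular_occurrence sigma X pi f]
  end.

Definition Av (n : nat) (P : pattern) : {set 'S_n} :=
  [set pi | ~~ occurs P pi].

Definition coincident (P Q : pattern) : Prop := forall n, Av n P = Av n Q.

(* One-line notation with values 1, ..., k, and the increasing list of the
   bonds as elements of {1, ..., k - 1}.  The words determine k, the permutation
   and the bond set, so equality of words is equality of patterns. *)
Definition one_line (k : nat) (s : 'S_k) : seq nat :=
  [seq (s i).+1 | i : 'I_k <- enum 'I_k].

Definition bonds (k : nat) (X : {set 'I_k.-1}) : seq nat :=
  [seq x.+1 | x : 'I_k.-1 <- enum X].

(* Main.v *)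
Require Import Defs.
From mathcomp Require Import all_boot all_fingroup.
From mathcomp Require Import zify.

(** An occurrence of either pattern makes the permutation at least as long as
    the pattern, and the only permutation of that length containing it is its
    own underlying permutation; hence coincident patterns have tau = sigma.
    What remains is to compare, for one permutation sigma of length k, the
    absence of points from the box with the adjacency of bonded positions.

    Necessity is decided by the permutations of length k + 1.  Such a
    permutation contains sigma classically exactly when it is
    [lift_perm p w sigma] for some p and w, that is, when deleting the point of
    position p and value w leaves sigma; the occurrence is one of Box(sigma)
    when that point is leftmost, rightmost, lowest or highest
    ([occurs_Box_extension]), and one of the vincular pattern when it does not
    split a bond ([occurs_Vincular_extension]).  If the permutation is also
    [lift_perm y v sigma] with y different from p, the point (y, v) must have a
    consecutive value next to it ([lift_perm_neighbour]).
    - Put a lowest, or a highest, point inside a bond.  The result contains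
      Box(sigma), so deleting another point must also give sigma, and the
      smallest, or largest, entry of sigma is an end of that bond.  There is
      therefore a single bond, and it joins 1 and k ([bond_joins_extremes],
      [bond_unique]).
    - Put a point of value gap v, 0 < v < k, inside an unbonded gap.  The result
      contains the vincular pattern, hence Box(sigma), and since the new point is
      interior another one can be deleted: v is just above or just below one of
      the two entries around the gap ([gap_values]).  Around a gap next to
      the bond, one of these entries is 1 or k, which allows only one of the
      inner values, and the other entry allows two.  So k - 1 <= 3
      ([coincident_length_le4]), and when k = 4 only six words are left, four of
      which are refuted by a permutation of length 5 ([no_outer_extension]).

    Sufficiency.  When the bond joins 1 and k, an occurrence of Box(sigma) has
    no value strictly between its extremes at the positions between its bonded
    entries, so the values there jump from one side of the box to the other at
    two adjacent positions, which can replace the bonded entries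
    ([Box_sub_Vincular]).  Conversely, an occurrence of the vincular pattern
    that is small enough has an empty box.  For k <= 3 the entry off the bond is
    taken as close to the bond as possible ([Vincular_sub_Box_short]).  For 3142
    the bond is first relaxed to the condition that no point between the two
    middle positions has its value between the two middle values; among the
    occurrences satisfying it, one of least width plus height has an empty box
    ([empty_box_3142]).  Complementing values exchanges the four listed patterns
    whose bond is an ascent with the four others. *)

Set Implicit Arguments.
Unset Strict Implicit.
Unset Printing Implicit Defensive.

(* Applications of finite functions to ordinals may carry the types of their
   arguments in two convertible forms, which simplification makes equal. *)
Ltac slia := simpl in *; lia.

(** * Occurrences *)

Lemma increasingP (k n : nat) (f : {ffun 'I_k -> 'I_n}) :
  reflect (forall a b : 'I_k, a < b -> f a < f b) (increasing f).
Proof.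
apply: (iffP forallP) => [H a b ab|H a].
  by move/forallP: (H a) => /(_ b) /implyP; apply.
by apply/forallP => b; apply/implyP; apply: H.
Qed.

Lemma order_isomorphicP (k n : nat) (tau : 'S_k) (pi : 'S_n)
    (f : {ffun 'I_k -> 'I_n}) :
  reflect (forall a b, (pi (f a) < pi (f b)) = (tau a < tau b))
          (order_isomorphic tau pi f).
Proof.
apply: (iffP forallP) => [H a b|H a].
  by move/forallP: (H a) => /(_ b) /eqP.
by apply/forallP => b; apply/eqP.
Qed.

Lemma box_occurrenceP (k n : nat) (tau : 'S_k) (pi : 'S_n)
    (f : {ffun 'I_k -> 'I_n}) :
  reflect [/\ increasing f, order_isomorphic tau pi f
            & forall j, j \notin codom f -> ~~ in_box pi f j]
          (box_occurrence tau pi f).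
Proof.
apply: (iffP and3P) => -[-> -> H]; split=> //.
  move=> j jf; apply: contra H => jb; apply/existsP; exists j; exact/andP.
by apply/existsP => -[j /andP[jf]]; apply/negP; apply: H.
Qed.

Lemma vincular_occurrenceP (k n : nat) (sigma : 'S_k) (X : {set 'I_k.-1})
    (pi : 'S_n) (f : {ffun 'I_k -> 'I_n}) :
  reflect [/\ increasing f, order_isomorphic sigma pi f
            & forall (x : 'I_k.-1) (a b : 'I_k), x \in X ->
                a = x :> nat -> b = x.+1 :> nat -> f b = (f a).+1 :> nat]
          (vincular_occurrence sigma X pi f).
Proof.
apply: (iffP and3P) => -[-> -> H]; split=> //.
  move=> x a b xX ax bx; move/forall_inP: H => /(_ x xX) /forallP/(_ a)/forallP.
  by move/(_ b); rewrite ax bx !eqxx /= => /eqP.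
apply/forall_inP => x xX; apply/forallP => a; apply/forallP => b.
by apply/implyP => /eqP ax; apply/implyP => /eqP bx; apply/eqP/(H x).
Qed.

Lemma coincidentP (P Q : pattern) :
  coincident P Q <-> forall n (pi : 'S_n), occurs P pi = occurs Q pi.
Proof.
split=> [H n pi|H n]; last by apply/setP => pi; rewrite !inE H.
by move/setP: (H n) => /(_ pi); rewrite !inE => /negb_inj.
Qed.

Lemma order_isomorphic_le (k n : nat) (tau : 'S_k) (pi : 'S_n)
    (f : {ffun 'I_k -> 'I_n}) :
  order_isomorphic tau pi f ->
  forall a b, (pi (f a) <= pi (f b)) = (tau a <= tau b).
Proof. by move/order_isomorphicP=> H a b; rewrite leqNgt H -leqNgt. Qed.

(** * Complementation of values *)

Definition complement (n : nat) (s : 'S_n) : 'S_n :=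
  perm (inj_comp (@rev_ord_inj n) (@perm_inj _ s)).

Lemma complementE (n : nat) (s : 'S_n) i : complement s i = n - (s i).+1 :> nat.
Proof. by rewrite permE. Qed.

Lemma ltn_complement (n : nat) (s : 'S_n) i j :
  (complement s i < complement s j) = (s j < s i).
Proof. by rewrite !complementE; have := ltn_ord (s i); have := ltn_ord (s j); lia. Qed.

Lemma order_isomorphic_complement (k n : nat) (tau : 'S_k) (pi : 'S_n) f :
  order_isomorphic (complement tau) (complement pi) f =
  order_isomorphic tau pi f.
Proof.
by apply/order_isomorphicP/order_isomorphicP => H a b; have := H b a;
  rewrite !ltn_complement.
Qed.

Lemma in_box_complement (k n : nat) (pi : 'S_n) (f : {ffun 'I_k -> 'I_n}) j :
  in_box (complement pi) f j = in_box pi f j.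
Proof.
rewrite /in_box; do 2 congr (_ && _); rewrite andbC.
by congr (_ && _); apply: eq_existsb => r; rewrite ltn_complement.
Qed.

Lemma occurs_Box_complement (k n : nat) (tau : 'S_k) (pi : 'S_n) :
  occurs (Box (complement tau)) (complement pi) = occurs (Box tau) pi.
Proof.
apply: eq_existsb => f.
rewrite /box_occurrence order_isomorphic_complement; congr [&& _, _ & ~~ _].
by apply: eq_existsb => j; rewrite in_box_complement.
Qed.

Lemma occurs_Vincular_complement (k n : nat) (sigma : 'S_k) X (pi : 'S_n) :
  occurs (Vincular (complement sigma) X) (complement pi) =
  occurs (Vincular sigma X) pi.
Proof.
by apply: eq_existsb => f; rewrite /vincular_occurrence order_isomorphic_complement.
Qed.

(** The box and the adjacency of positions do not see the orientation of values,
    so each descending pattern is reduced to an ascending one. *)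
Lemma coincident_complement (k m : nat) (tau : 'S_m) (sigma : 'S_k) X :
  coincident (Box (complement tau)) (Vincular (complement sigma) X) ->
  coincident (Box tau) (Vincular sigma X).
Proof.
move/coincidentP=> H; apply/coincidentP => n pi.
by rewrite -occurs_Box_complement -occurs_Vincular_complement H.
Qed.

(** * Changing one entry of an occurrence *)

Definition replace (k n : nat) (f : {ffun 'I_k -> 'I_n}) r j : {ffun 'I_k -> 'I_n} :=
  [ffun i => if i == r then j else f i].

(** Any point that compares with the remaining entries as the removed one did
    can take its place; it is enough to test implications, since distinct
    entries of sigma are comparable. *)
Lemma replace_entry (k n : nat) (sigma : 'S_k) (pi : 'S_n)
    (f : {ffun 'I_k -> 'I_n}) (r : 'I_k) (j : 'I_n) :
  increasing f -> order_isomorphic sigma pi f ->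
  (forall i : 'I_k, i < r -> f i < j) -> (forall i : 'I_k, r < i -> j < f i) ->
  (forall i, sigma i < sigma r -> pi (f i) < pi j) ->
  (forall i, sigma r < sigma i -> pi j < pi (f i)) ->
  increasing (replace f r j) /\ order_isomorphic sigma pi (replace f r j).
Proof.
move=> /increasingP finc /order_isomorphicP fiso lf rt lo hi; split.
  apply/increasingP => a b; rewrite !ffunE.
  case: (eqVneq a r) => [->|ar]; case: (eqVneq b r) => [->|br]; rewrite ?ltnn //.
  - exact: rt.
  - exact: lf.
  - exact: finc.
have cmp i : i != r -> ((pi (f i) < pi j) = (sigma i < sigma r)) /\
    ((pi j < pi (f i)) = (sigma r < sigma i)).
  move=> ir; have : sigma i != sigma r by rewrite (inj_eq perm_inj).
  rewrite -val_eqE neq_ltn /= => /orP[] h.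
    by have := lo i h; lia.
  by have := hi i h; lia.
apply/order_isomorphicP => a b; rewrite !ffunE.
case: (eqVneq a r) => [->|ar]; case: (eqVneq b r) => [->|br]; rewrite ?ltnn //.
- exact: (cmp b br).2.
- exact: (cmp a ar).1.
Qed.

(** * Patterns whose only bond is an ascent from 1 to k *)

Lemma crossing (P : pred nat) (lo hi : nat) : lo <= hi -> P lo -> ~~ P hi ->
  exists p, [/\ lo <= p, p < hi, P p & ~~ P p.+1].
Proof.
elim: hi => [|hi IH]; first by rewrite leqn0 => /eqP -> ->.
move=> le Pl NP; have [Phi|NPhi] := boolP (P hi).
  exists hi; split=> //; move: le; rewrite leq_eqVlt => /orP[/eqP E|//].
  by rewrite -E Pl in NP.
have lh : lo <= hi.
  by move: le; rewrite leq_eqVlt => /orP[/eqP E|//]; rewrite -E Pl in NP.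
by have [p [? ? ? ?]] := IH lh Pl NPhi; exists p; split=> //; slia.
Qed.

Section SingleBond.

Variables (k : nat) (sigma : 'S_k) (X : {set 'I_k.-1}) (a b : 'I_k).
Hypothesis ab : b = a.+1 :> nat.
Hypothesis Xa : forall z : 'I_k.-1, (z \in X) = (z == a :> nat).

Lemma vincular_single n (pi : 'S_n) (f : {ffun 'I_k -> 'I_n}) :
  reflect [/\ increasing f, order_isomorphic sigma pi f & f b = (f a).+1 :> nat]
    (vincular_occurrence sigma X pi f).
Proof.
apply: (iffP (vincular_occurrenceP _ _ _ _)) => -[fi fo H]; split=> //.
  have ak : a < k.-1 by have := ltn_ord b; slia.
  by apply: (H (Ordinal ak)) => //; rewrite Xa.
move=> x a' b'; rewrite Xa => /eqP -> a'a b'a.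
have -> : a' = a by apply: val_inj.
by have -> : b' = b by apply: val_inj; rewrite /= b'a ab.
Qed.

Hypotheses (sa : sigma a = 0 :> nat) (sb : sigma b = k.-1 :> nat).

Lemma sigma_lt_b i : i != b -> sigma i < sigma b.
Proof.
move=> ib; have := ltn_ord (sigma i).
have : sigma i != sigma b by rewrite (inj_eq perm_inj).
by rewrite -val_eqE /= sb; slia.
Qed.

Lemma sigma_a_lt i : i != a -> sigma a < sigma i.
Proof.
move=> ia; have : sigma i != sigma a by rewrite (inj_eq perm_inj).
by rewrite -val_eqE /= sa; slia.
Qed.

(** The positions between the bonded entries of a box occurrence carry values
    at most that of the first or at least that of the second.  The place where
    the values leave the lower kind is a pair j, q of adjacent positions whose
    values are at least as extreme as those of the bonded entries, so j and q
    compare with the other entries in the same way. *)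
Lemma Box_sub_Vincular n (pi : 'S_n) :
  occurs (Box sigma) pi -> occurs (Vincular sigma X) pi.
Proof.
case/existsP=> f /box_occurrenceP[fi fo fbox].
have /increasingP inc := fi; have /order_isomorphicP iso := fo.
have fab : f a < f b by apply: inc; slia.
have pab : pi (f a) < pi (f b) by rewrite iso; apply: sigma_a_lt; rewrite -val_eqE /=; slia.
pose P i := [exists j : 'I_n, (j == i :> nat) && (pi j <= pi (f a))].
have [||p [fap pfb /existsP[j /andP[/eqP jp pj]] NP]] := crossing (P := P) (ltnW fab).
- by apply/existsP; exists (f a); rewrite eqxx /=.
- apply/existsP => -[j /andP[/eqP/val_inj ->]]; slia.
have qn : p.+1 < n by have := ltn_ord (f b); slia.
have [q qp] : exists q : 'I_n, q = p.+1 :> nat by exists (Ordinal qn).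
have pq : pi (f a) < pi q.
  by rewrite ltnNge; apply: contra NP => h; apply/existsP; exists q; rewrite qp eqxx.
have qb : pi (f b) <= pi q.
  have [qfb|qfb] := eqVneq q (f b); first by rewrite qfb.
  have qlt : q < f b by rewrite ltn_neqAle qfb qp.
  have /fbox : q \notin codom f.
    apply/negP => /codomP[i qi].
    have [ia|ia] := leqP i a.
      have : f i <= f a.
        by move: ia; rewrite leq_eqVlt => /orP[/eqP/val_inj ->//|/inc/ltnW].
      by rewrite -qi qp; slia.
    have : f b <= f i.
      by move: ia; rewrite -ab leq_eqVlt => /orP[/eqP/val_inj ->//|/inc/ltnW].
    by rewrite -qi; slia.
  rewrite leqNgt; apply: contra => h; rewrite /in_box; apply/and4P; split.
  - by (have faq : f a < q by slia); apply/existsP; exists a.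
  - by apply/existsP; exists b.
  - by apply/existsP; exists a.
  - by apply/existsP; exists b.
have bna : (b == a) = false by rewrite -val_eqE /=; slia.
(* The bonded entries are moved to j and q one after the other. *)
have [gi go] : increasing (replace f a j) /\
    order_isomorphic sigma pi (replace f a j).
  apply: replace_entry => // i h; first by have := inc _ _ h; slia.
  - have [->|ib] := eqVneq i b; first slia.
    have := inc b i; move: ib; rewrite -val_eqE /= => ib H.
    have : b < i by slia.
    by move/H; slia.
  - by rewrite sa in h.
  - by move: h; rewrite -iso; slia.
have [hi ho] : increasing (replace (replace f a j) b q) /\
    order_isomorphic sigma pi (replace (replace f a j) b q).
  apply: replace_entry => // i h; rewrite ffunE.
  - case: (eqVneq i a) => [_|ia]; first by rewrite /=; slia.
    have : i < a by move: ia; rewrite -val_eqE /=; slia.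
    by move/inc; rewrite /=; slia.
  - case: (eqVneq i a) => [ia|ia]; first by rewrite ia in h; slia.
    by have := inc _ _ h; rewrite /=; slia.
  - case: (eqVneq i a) => [_|ia]; first by slia.
    by move: h; rewrite -iso; slia.
  - by have := ltn_ord (sigma i); rewrite sb in h; slia.
apply/existsP; exists (replace (replace f a j) b q).
apply/vincular_single; split=> //.
by rewrite !ffunE eqxx eq_sym bna eqxx /= jp.
Qed.

(** With at most three entries, the entry off the bond has the only middle
    value, so any point of the box can take its place.  Such a point lies on the
    same side of the bond and closer to it, which the choice of an occurrence
    with entries nearest to the bond excludes. *)
Lemma Vincular_sub_Box_short n (pi : 'S_n) : k <= 3 ->
  occurs (Vincular sigma X) pi -> occurs (Box sigma) pi.
Proof.
move=> k3 /existsP[f0 f0V].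
pose spread (f : {ffun 'I_k -> 'I_n}) := \sum_i ((f i - f a) + (f a - f i)).
case: (arg_minnP spread f0V) => f /vincular_single[fi fo fab] fmin.
have /increasingP inc := fi; have /order_isomorphicP iso := fo.
have le := order_isomorphic_le fo.
apply/existsP; exists f; apply/box_occurrenceP; split=> // j jf.
apply/negP => /and4P[/existsP[r1 h1] /existsP[r2 h2] /existsP[r3 h3] /existsP[r4 h4]].
have {}h1 : f r1 < j := h1.
have {}h2 : j < f r2 := h2.
have {}h4 : pi j < pi (f r4) := h4.
have ne i : j != f i by apply: contraNneq jf => ->; exact: codom_f.
have paj : pi (f a) < pi j by apply: leq_ltn_trans h3; rewrite le sa.
have pjb : pi j < pi (f b).
  apply: (leq_trans h4); rewrite le sb; have := ltn_ord (sigma r4); slia.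
have far r : r != a -> r != b ->
    (r < a /\ f r < j /\ j < f a) \/ (b < r /\ f b < j /\ j < f r) -> False.
  move=> ra rb rj.
  have third (i : 'I_k) : i != r -> i = a \/ i = b.
    move: ra rb rj; rewrite -!val_eqE /= => ra rb rj ir.
    by have := (ltn_ord i, ltn_ord r, ltn_ord b); case=> -[? ?] ?;
      (have [E|E] : i = a :> nat \/ i = b :> nat by slia); [left|right]; apply: val_inj.
  have [gi go] : increasing (replace f r j) /\ order_isomorphic sigma pi (replace f r j).
  { apply: replace_entry => // i h;
      have /third[E|E] : i != r by (apply: contraTneq h => ->; rewrite ltnn).
    all: move: h; rewrite {}E => h; try slia.
    by have := sigma_lt_b rb; slia. }
  have gV : vincular_occurrence sigma X pi (replace f r j).
    apply/vincular_single; split=> //.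
    by rewrite !ffunE ![_ == r]eq_sym (negbTE ra) (negbTE rb).
  have := fmin _ gV; rewrite /spread (bigD1 r) //= [X in _ <= X](bigD1 r) //=.
  rewrite [X in _ <= _ + X](eq_bigr (fun i => (f i - f a) + (f a - f i))); last first.
    by move=> i ir; rewrite !ffunE (negbTE ir) [a == r]eq_sym (negbTE ra).
  by rewrite leq_add2r !ffunE eqxx [a == r]eq_sym (negbTE ra); slia.
have := (ne a, ne b); rewrite -!val_eqE /= => -[na nb].
have [ja|ja] := ltnP j (f a).
  have r1a : r1 < a.
    rewrite ltnNge leq_eqVlt; apply/negP => /orP[/eqP/val_inj E|/inc ?]; last slia.
    by rewrite -E in h1; slia.
  by apply: (far r1); rewrite -?val_eqE /=; slia.
have r2b : b < r2.
  rewrite ltnNge leq_eqVlt; apply/negP => /orP[/eqP/val_inj E|/inc ?]; last slia.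
  by rewrite E in h2; slia.
by apply: (far r2); rewrite -?val_eqE /=; slia.
Qed.

End SingleBond.

(** * Shrinking an occurrence of 3142 to an empty box *)

Section Tight.

Variables (n : nat) (pi : 'S_n).
Implicit Types p q z : 'I_n.

(** The condition on the points between p1 and p2 is what the bond of 3142
    leaves when p1 and p2 are no longer adjacent.  Unlike adjacency, it survives
    replacing p1 or p2 by a point of the box. *)
Definition barred_3142 p0 p1 p2 p3 :=
  [/\ p0 < p1 < p2, p2 < p3, pi p1 < pi p3 < pi p0, pi p0 < pi p2
    & forall z, p1 < z < p2 -> ~~ (pi p3 < pi z < pi p0)].

(** Write L, M, H for the values between those of p1 and p3, of p3 and p0, of p0
    and p2.  A point of the box, whose position lies in one of the three intervals cut out by
    p0 < p1 < p2 < p3, can replace an entry: p0 or p3, which makes the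
    occurrence narrower, or p1 or p2, which makes it less high.  Each of
    the two dimensions depends on its own pair of entries, so their sum drops.
    The difficulty is to keep the condition on the points between p1 and p2.
    Points of value M, and those of the middle interval, come first: replacing an
    entry by one of them never breaks it.  Once they are all excluded, nothing of
    the box is left between p1 and p2, so p0 may go up and p3 may go down; and no
    value M is left to the left of p1 or to the right of p2, so p1 may
    move left and p2 may move right. *)
Lemma empty_box_3142 p0 p1 p2 p3 : barred_3142 p0 p1 p2 p3 ->
  exists q0 q1 q2 q3,
    [/\ q0 < q1 < q2, q2 < q3, pi q1 < pi q3 < pi q0, pi q0 < pi q2
      & forall z, q0 < z < q3 -> z != q1 -> z != q2 -> ~~ (pi q1 < pi z < pi q2)].
Proof.
move: {2}_.+1 (ltnSn ((p3 - p0) + (pi p2 - pi p1))) => N.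
elim: N p0 p1 p2 p3 => // N IH p0 p1 p2 p3 small [h012 h23 v130 v02 mid].
have [z /andP[zp zv]|I1M] := pickP [pred z : 'I_n | (p0 < z < p1) && (pi p3 < pi z < pi p0)].
  apply: (IH z p1 p2 p3); first slia.
  by split; try slia; move=> y /mid; slia.
have [z /andP[zp zv]|I3M] := pickP [pred z : 'I_n | (p2 < z < p3) && (pi p3 < pi z < pi p0)].
  apply: (IH p0 p1 p2 z); first slia.
  by split; try slia; move=> y /mid; slia.
have [z /andP[zp zv]|I2L] := pickP [pred z : 'I_n | (p1 < z < p2) && (pi p1 < pi z < pi p3)].
  apply: (IH p0 z p2 p3); first slia.
  by split; try slia; move=> y yz; apply: mid; slia.
have [z /andP[zp zv]|I2H] := pickP [pred z : 'I_n | (p1 < z < p2) && (pi p0 < pi z < pi p2)].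
  apply: (IH p0 p1 z p3); first slia.
  by split; try slia; move=> y yz; apply: mid; slia.
have inj z y : z != y -> pi z != pi y :> nat.
  by move=> h; rewrite val_eqE (inj_eq perm_inj).
have I2 z : p1 < z < p2 -> ~~ (pi p1 < pi z < pi p2).
  move=> h; have := (mid z h, I2L z, I2H z); rewrite /= h /= => -[[? ?] ?].
  have zp0 : z != p0 by rewrite -val_eqE /=; slia.
  have zp3 : z != p3 by rewrite -val_eqE /=; slia.
  by have := inj _ _ zp0; have := inj _ _ zp3; slia.
have [z /andP[zp zv]|I1H] := pickP [pred z : 'I_n | (p0 < z < p1) && (pi p0 < pi z < pi p2)].
  apply: (IH z p1 p2 p3); first slia.
  by split; try slia; move=> y /I2; slia.
have [z /andP[zp zv]|I3L] := pickP [pred z : 'I_n | (p2 < z < p3) && (pi p1 < pi z < pi p3)].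
  apply: (IH p0 p1 p2 z); first slia.
  by split; try slia; move=> y /I2; slia.
have [z /andP[zp zv]|I1L] := pickP [pred z : 'I_n | (p0 < z < p1) && (pi p1 < pi z < pi p3)].
  apply: (IH p0 z p2 p3); first slia.
  split; try slia; move=> y yz.
  have [yp1|yp1] := ltnP y p1; first by have := I1M y; rewrite /=; slia.
  have [->|yp] := eqVneq y p1; first slia.
  by apply: mid; move: yp; rewrite -val_eqE /=; slia.
have [z /andP[zp zv]|I3H] := pickP [pred z : 'I_n | (p2 < z < p3) && (pi p0 < pi z < pi p2)].
  apply: (IH p0 p1 z p3); first slia.
  split; try slia; move=> y yz.
  have [yp2|yp2] := ltnP p2 y; first by have := I3M y; rewrite /=; slia.
  have [->|yp] := eqVneq y p2; first slia.
  by apply: mid; move: yp; rewrite -val_eqE /=; slia.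
exists p0, p1, p2, p3; split=> // z zp zp1 zp2.
have zp0 : z != p0 by rewrite -val_eqE /=; slia.
have zp3 : z != p3 by rewrite -val_eqE /=; slia.
have := inj _ _ zp0; have := inj _ _ zp3; move: zp1 zp2; rewrite -!val_eqE /= => zp1 zp2.
have := I1M z; have := I3M z; have := I1H z; have := I3L z.
have := I1L z; have := I3H z; have := I2 z; slia.
Qed.

End Tight.

(** * The listed pairs are coincident *)

Lemma size_one_line (k : nat) (s : 'S_k) : size (one_line s) = k.
Proof. by rewrite size_map size_enum_ord. Qed.

Lemma nth_one_line (k : nat) (s : 'S_k) (i : 'I_k) :
  nth 0 (one_line s) i = (s i).+1.
Proof. by rewrite (nth_map i) ?size_enum_ord // nth_ord_enum. Qed.

Lemma one_line_inj (k : nat) : injective (@one_line k).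
Proof.
move=> s t E; apply/permP => i; apply/val_inj/succn_inj.
by rewrite -!nth_one_line E.
Qed.

Lemma bonds_single (k : nat) (X : {set 'I_k.-1}) (c : nat) :
  bonds X = [:: c.+1] -> forall z : 'I_k.-1, (z \in X) = (z == c :> nat).
Proof.
move=> E z; rewrite -mem_enum -(@mem_map _ _ (fun x : 'I_k.-1 => x.+1)).
  by rewrite -/(bonds X) E inE eqSS.
by move=> x y [] /val_inj.
Qed.

Lemma Vincular_sub_Box_3142 (sigma : 'S_4) (X : {set 'I_4.-1}) n (pi : 'S_n) :
  one_line sigma = [:: 3; 1; 4; 2] -> bonds X = [:: 2] ->
  occurs (Vincular sigma X) pi -> occurs (Box sigma) pi.
Proof.
move=> w B /existsP[f /vincular_occurrenceP[/increasingP inc /order_isomorphicP iso fX]].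
have v (i : 'I_4) : sigma i = nth 0 [:: 2; 0; 3; 1] i :> nat.
  by apply: succn_inj; rewrite -nth_one_line w; case: i => -[|[|[|[|]]]].
pose o i (lti : i < 4) := Ordinal lti.
have f21 : f (@o 2 isT) = (f (@o 1 isT)).+1 :> nat.
  by apply: (fX (@Ordinal 3 1 isT)) => //; rewrite (bonds_single B).
have bar : barred_3142 pi (f (@o 0 isT)) (f (@o 1 isT)) (f (@o 2 isT)) (f (@o 3 isT)).
  split; rewrite ?iso ?v ?inc // => z; rewrite f21; lia.
have [q0 [q1 [q2 [q3 [q012 q23 v130 v02 empty]]]]] := empty_box_3142 bar.
apply/existsP; exists [ffun i : 'I_4 => nth q0 [:: q0; q1; q2; q3] i].
apply/box_occurrenceP; split.
- apply/increasingP => -[[|[|[|[|a]]]] lta] // -[[|[|[|[|b]]]] ltb] //;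
  rewrite !ffunE /= => _; lia.
- apply/order_isomorphicP => -[[|[|[|[|a]]]] lta] // -[[|[|[|[|b]]]] ltb] //;
  rewrite !ffunE !v /=; lia.
- move=> j jq.
  have ne (i : 'I_4) : j != nth q0 [:: q0; q1; q2; q3] i.
    apply: contraNneq jq => ->; apply/codomP; exists i; by rewrite ffunE.
  apply/negP => /and4P[/existsP[r1 h1] /existsP[r2 h2] /existsP[r3 h3] /existsP[r4 h4]].
  have : q0 < j < q3.
    move: h1 h2; rewrite !ffunE.
    by case: r1 => -[|[|[|[|r1]]]] // ?; case: r2 => -[|[|[|[|r2]]]] // ?; rewrite /=; lia.
  move/empty => /(_ (ne (@o 1 isT)) (ne (@o 2 isT))) /negP; apply.
  move: h3 h4; rewrite !ffunE.
  by case: r3 => -[|[|[|[|r3]]]] // ?; case: r4 => -[|[|[|[|r4]]]] // ?; rewrite /=; lia.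
Qed.

Definition ascending_patterns : seq (seq nat * seq nat) :=
  [:: ([:: 1; 2], [:: 1]); ([:: 1; 3; 2], [:: 1]);
      ([:: 2; 1; 3], [:: 2]); ([:: 3; 1; 4; 2], [:: 2])].

Lemma coincident_ascent_listed (k : nat) (sigma : 'S_k) (X : {set 'I_k.-1}) :
  (one_line sigma, bonds X) \in ascending_patterns ->
  coincident (Box sigma) (Vincular sigma X).
Proof.
have short c : c.+1 < k -> bonds X = [:: c.+1] -> nth 0 (one_line sigma) c = 1 ->
    nth 0 (one_line sigma) c.+1 = k -> k <= 3 \/
    (forall n (pi : 'S_n), occurs (Vincular sigma X) pi -> occurs (Box sigma) pi) ->
    coincident (Box sigma) (Vincular sigma X).
  move=> ck B w1 w2 H.
  have [sa sb] : sigma (Ordinal (ltnW ck)) = 0 :> nat /\ sigma (Ordinal ck) = k.-1 :> nat.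
    have := nth_one_line sigma (Ordinal (ltnW ck)); have := nth_one_line sigma (Ordinal ck).
    by rewrite /= w1 w2; lia.
  have Xa := bonds_single B.
  have ab : Ordinal ck = (Ordinal (ltnW ck)).+1 :> nat by [].
  apply/coincidentP => n pi; apply/idP/idP; first exact: (Box_sub_Vincular ab Xa sa sb).
  by case: H => [k3|]; [exact: (Vincular_sub_Box_short ab Xa sa sb k3)|apply].
have sz := size_one_line sigma.
rewrite /ascending_patterns !inE !xpair_eqE => /or4P[] /andP[/eqP w /eqP B];
  rewrite w /= in sz; subst k.
- by apply: (short 0); rewrite ?w //; left.
- by apply: (short 0); rewrite ?w //; left.
- by apply: (short 1); rewrite ?w //; left.
- by apply: (short 1); rewrite ?w //; right => n pi; apply: Vincular_sub_Box_3142.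
Qed.

Lemma one_line_complement (k : nat) (s : 'S_k) :
  one_line (complement s) = [seq k.+1 - v | v <- one_line s].
Proof.
rewrite /one_line -map_comp; apply: eq_map => i /=.
by rewrite complementE; have := ltn_ord (s i); lia.
Qed.

Definition listed_patterns : seq (seq nat * seq nat) :=
  [:: ([:: 1; 2], [:: 1]);
      ([:: 2; 1], [:: 1]);
      ([:: 1; 3; 2], [:: 1]);
      ([:: 2; 1; 3], [:: 2]);
      ([:: 2; 3; 1], [:: 2]);
      ([:: 3; 1; 2], [:: 1]);
      ([:: 2; 4; 1; 3], [:: 2]);
      ([:: 3; 1; 4; 2], [:: 2])].

Lemma coincident_listed (k : nat) (sigma : 'S_k) (X : {set 'I_k.-1}) :
  (one_line sigma, bonds X) \in listed_patterns ->
  coincident (Box sigma) (Vincular sigma X).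
Proof.
move=> H; suff [|] : (one_line sigma, bonds X) \in ascending_patterns \/
   (one_line (complement sigma), bonds X) \in ascending_patterns.
- exact: coincident_ascent_listed.
- by move=> H'; apply: coincident_complement; apply: coincident_ascent_listed.
have := size_one_line sigma; rewrite one_line_complement.
move: H; rewrite /listed_patterns !inE => H; do ?(case/orP: H => H);
  move/eqP: H => [-> ->] /= <-; by [left|right].
Qed.

(** * Increasing maps between ordinals *)

Lemma leq_increasing (k n : nat) (g : 'I_k -> 'I_n) :
  (forall a b : 'I_k, a < b -> g a < g b) -> forall i : 'I_k, i <= g i.
Proof.
move=> inc [i]; elim: i => // i IH lti /=.
by apply: leq_ltn_trans (IH (ltnW lti)) _; apply: inc.
Qed.

Lemma increasing_id (k : nat) (g : 'I_k -> 'I_k) :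
  (forall a b : 'I_k, a < b -> g a < g b) -> g =1 id.
Proof.
move=> inc i; apply: val_inj; apply/eqP; rewrite eqn_leq (leq_increasing inc) andbT.
have rinc (a b : 'I_k) : a < b -> rev_ord (g (rev_ord a)) < rev_ord (g (rev_ord b)).
  move=> ab; have : g (rev_ord b) < g (rev_ord a).
    by apply: inc; rewrite /=; have := ltn_ord b; lia.
  by rewrite /=; have := ltn_ord (g (rev_ord a)); lia.
have := leq_increasing rinc (rev_ord i); rewrite rev_ordK /=.
by have := ltn_ord (g i); have := ltn_ord i; lia.
Qed.

(** A permutation is determined by the order of its values, because an increasing
    map from an ordinal to itself is the identity. *)
Lemma same_order (k : nat) (g : 'I_k -> 'I_k) (t : 'S_k) :
  (forall a b, (g a < g b) = (t a < t b)) -> g =1 t.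
Proof.
move=> H i; rewrite -[in LHS](permK t i).
apply: (increasing_id (g := fun j => g ((t^-1)%g j))) => a b ab.
by rewrite H !permKV.
Qed.

Lemma increasing_leq_size (k n : nat) (f : {ffun 'I_k -> 'I_n}) :
  increasing f -> k <= n.
Proof.
move=> /increasingP inc; case: k f inc => // k f inc.
exact: leq_ltn_trans (leq_increasing inc ord_max) (ltn_ord _).
Qed.

Lemma ltn_lift (k : nat) (h : 'I_k) (a b : 'I_k.-1) :
  (lift h a < lift h b) = (a < b).
Proof. by rewrite /= /bump; lia. Qed.

Lemma increasing_skip (k : nat) (f : 'I_k -> 'I_k.+1) :
  (forall a b : 'I_k, a < b -> f a < f b) -> exists p : 'I_k.+1, f =1 lift p.
Proof.
move=> inc.
have /existsP[p pf] : [exists p, p \notin codom f].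
  rewrite -negb_forall; apply/negP => /forallP H.
  have : #|codom f| <= #|'I_k| by exact: leq_image_card.
  have /eq_card -> : codom f =i 'I_k.+1 by move=> i; rewrite H.
  by rewrite !card_ord ltnn.
exists p; pose g i := odflt i (unlift p (f i)).
have fg i : f i = lift p (g i).
  rewrite /g; case: unliftP => [j ->|E] //=.
  by case/negP: pf; rewrite -E codom_f.
move=> i; rewrite fg; congr lift; move: i; apply: increasing_id => a b ab.
by rewrite -(ltn_lift p) -!fg inc.
Qed.

(** * Occurrences in permutations with one more point *)

Section Extensions.

Variables (k : nat) (sigma : 'S_k).

(** An occurrence in a permutation with one more point skips a single position p,
    and deleting the point at p leaves sigma itself. *)
Lemma classical_extension (pi : 'S_k.+1) (f : {ffun 'I_k -> 'I_k.+1}) :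
  increasing f -> order_isomorphic sigma pi f ->
  exists p : 'I_k.+1, f =1 lift p /\ pi = lift_perm p (pi p) sigma.
Proof.
move=> /increasingP inc /order_isomorphicP iso.
have [p fp] := increasing_skip inc; exists p; split=> //.
pose g i := odflt i (unlift (pi p) (pi (lift p i))).
have pig i : pi (lift p i) = lift (pi p) (g i).
  rewrite /g; case: unliftP => [j ->|/perm_inj E] //=.
  by have := neq_lift p i; rewrite E eqxx.
have gs : g =1 sigma.
  by apply: same_order => a b; rewrite -(ltn_lift (pi p)) -!pig -!fp iso.
apply/permP => j; case: (unliftP p j) => [i ->|->].
  by rewrite lift_perm_lift pig gs.
by rewrite lift_perm_id.
Qed.

Lemma extension_classical (p w : 'I_k.+1) (f := [ffun i : 'I_k => lift p i]) :
  increasing f /\ order_isomorphic sigma (lift_perm p w sigma) f.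
Proof.
split; first by apply/increasingP => a b; rewrite !ffunE ltn_lift.
by apply/order_isomorphicP => a b; rewrite !ffunE !lift_perm_lift ltn_lift.
Qed.

Definition outer (p : 'I_k.+1) := (p == 0 :> nat) || (p == k :> nat).

(** The skipped point is the only one that can lie in the box, and it lies outside
    exactly when it is extreme in position or in value: otherwise each of the
    four extreme points is an entry of the occurrence and bounds the box. *)
Lemma occurs_Box_extension (pi : 'S_k.+1) :
  occurs (Box sigma) pi <->
  exists p w, pi = lift_perm p w sigma /\ outer p || outer w.
Proof.
split=> [/existsP[f /box_occurrenceP[inc iso empty]]|[p [w [-> out]]]].
  have [p [fp pip]] := classical_extension inc iso; exists p, (pi p); split=> //.
  have surj q : q != p -> exists i, f i = q.
    by rewrite eq_sym => /unlift_some[i qi _]; exists i; rewrite fp.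
  have pf : p \notin codom f.
    by apply/negP => /codomP[i]; rewrite fp => /eqP; rewrite (negPf (neq_lift _ _)).
  have vsurj v : v != pi p -> exists i, pi (f i) = v.
    move=> vp; have [|i fi] := surj (pi^-1%g v); last by exists i; rewrite fi permKV.
    by apply: contra vp => /eqP <-; rewrite permKV.
  apply: contraR (empty p pf); rewrite negb_or /outer => out.
  have [p0 pk w0 wk] : [/\ 0 < p, p < k, 0 < pi p & pi p < k].
    by have := ltn_ord p; have := ltn_ord (pi p); split; lia.
  apply/and4P; split; apply/existsP.
  - have [|i fi] := surj ord0; first by rewrite -val_eqE /=; lia.
    by exists i; rewrite fi.
  - have [|i fi] := surj ord_max; first by rewrite -val_eqE /=; lia.
    by exists i; rewrite fi.
  - have [|i fi] := vsurj ord0; first by rewrite -val_eqE /=; lia.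
    by exists i; rewrite fi.
  - have [|i fi] := vsurj ord_max; first by rewrite -val_eqE /=; lia.
    by exists i; rewrite fi.
apply/existsP; exists [ffun i => lift p i].
have [inc iso] := extension_classical p w.
apply/box_occurrenceP; split=> // j.
case: (unliftP p j) => [i ->|-> _].
  by case/negP; apply/codomP; exists i; rewrite ffunE.
rewrite /in_box lift_perm_id; apply/negP.
move=> /and4P[/existsP[a ha] /existsP[b hb] /existsP[c hc] /existsP[d hd]].
have p0 : 0 < p := leq_ltn_trans (leq0n _) ha.
have pk : p < k := leq_trans hb (leq_ord _).
have w0 : 0 < w := leq_ltn_trans (leq0n _) hc.
have wk : w < k := leq_trans hd (leq_ord _).
by move: out; rewrite /outer; lia.
Qed.

(** A skipped position other than x + 1 moves both ends of the bond x alike. *)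
Lemma occurs_Vincular_extension (X : {set 'I_k.-1}) (pi : 'S_k.+1) :
  occurs (Vincular sigma X) pi <->
  exists p w, pi = lift_perm p w sigma /\ forall x, x \in X -> p != x.+1 :> nat.
Proof.
split=> [/existsP[f /vincular_occurrenceP[inc iso bond]]|[p [w [-> free]]]].
  have [p [fp pip]] := classical_extension inc iso; exists p, (pi p); split=> // x xX.
  have ltx := ltn_ord x.
  have [xk x1k] : x < k /\ x.+1 < k by lia.
  have := bond x (Ordinal xk) (Ordinal x1k) xX erefl erefl.
  by rewrite !fp /= /bump; lia.
apply/existsP; exists [ffun i => lift p i].
have [inc iso] := extension_classical p w.
apply/vincular_occurrenceP; split=> // x a b xX ax bx; rewrite !ffunE /= /bump.
by have := free x xX; lia.
Qed.

(** When deleting y or p leaves the same permutation, the point at y plays, after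
    the deletion of p, the role of the entry of sigma that precedes or follows
    it, according to the side on which p lies. *)
Lemma lift_perm_neighbour (y v p w : 'I_k.+1) :
  lift_perm y v sigma = lift_perm p w sigma -> p != y ->
  (exists a : 'I_k, [/\ p < y, a.+1 = y & v = bump w (sigma a) :> nat]) \/
  (exists b : 'I_k, [/\ y < p, b = y :> nat & v = bump w (sigma b) :> nat]).
Proof.
move=> E py.
have [i yi] : exists i : 'I_k, y = lift p i by have [i yi _] := unlift_some py; exists i.
have vi : v = lift w (sigma i) by rewrite -(lift_perm_id y v sigma) E yi lift_perm_lift.
have yi' : y = bump p i :> nat by rewrite yi.
have [py'|py'] := leqP p i; [left|right]; exists i.
  by split; last (by rewrite vi); rewrite yi' /bump; lia.
by split; last (by rewrite vi); rewrite yi' /bump; lia.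
Qed.

End Extensions.

(** * Constraints on a coincident pattern *)

Section Necessity.

Variables (k : nat) (sigma : 'S_k) (X : {set 'I_k.-1}).
Hypothesis coin : forall n (pi : 'S_n),
  occurs (Box sigma) pi = occurs (Vincular sigma X) pi.

(** A point of extreme value inserted inside the bond stays out of the box of sigma,
    but it splits the bond: the vincular pattern must occur by skipping another
    point, and the neighbour of the inserted point that takes over its role is
    extreme in sigma. *)
Lemma bond_extreme (x : 'I_k.-1) (a b : 'I_k) (v : 'I_k.+1) :
  x \in X -> a = x :> nat -> b = x.+1 :> nat -> outer v ->
  (sigma a = v.-1 :> nat) \/ (sigma b = v.-1 :> nat).
Proof.
move=> xX ax bx ov.
have ltx : x.+1 < k.+1 by have := ltn_ord x; lia.
pose y := Ordinal ltx.
have : occurs (Box sigma) (lift_perm y v sigma).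
  by apply/occurs_Box_extension; exists y, v; rewrite ov orbT.
rewrite coin => /occurs_Vincular_extension[p [w [E /(_ x xX) py]]].
case: (lift_perm_neighbour E py) => -[c [_ cy vc]].
  have -> : a = c by apply: val_inj; move: cy; rewrite /= ax; lia.
  left; move: ov vc; rewrite /outer /bump; have := ltn_ord (sigma c); lia.
have -> : b = c by apply: val_inj; move: cy; rewrite /= bx; lia.
right; move: ov vc; rewrite /outer /bump; have := ltn_ord (sigma c); lia.
Qed.

Lemma bond_joins_extremes (x : 'I_k.-1) (a b : 'I_k) :
  x \in X -> a = x :> nat -> b = x.+1 :> nat ->
  (sigma a = 0 :> nat /\ sigma b = k.-1 :> nat) \/
  (sigma a = k.-1 :> nat /\ sigma b = 0 :> nat).
Proof.
move=> xX ax bx.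
have := bond_extreme xX ax bx (v := ord0); have := bond_extreme xX ax bx (v := ord_max).
rewrite /outer /= eqxx orbT => /(_ isT) ? /(_ isT) ?.
by have := ltn_ord x; lia.
Qed.

Lemma sigma_inj_nat (a b : 'I_k) : sigma a = sigma b :> nat -> a = b :> nat.
Proof. by move/val_inj/perm_inj ->. Qed.

Lemma bond_unique (x z : 'I_k.-1) : x \in X -> (z \in X) = (z == x :> nat).
Proof.
move=> xX; apply/idP/eqP => [zX|/val_inj ->//].
have ord i : i < k -> exists a : 'I_k, a = i :> nat by move=> h; exists (Ordinal h).
have [|a ax] := ord x; first by have := ltn_ord x; lia.
have [|b bx] := ord x.+1; first by have := ltn_ord x; lia.
have [|c cz] := ord z; first by have := ltn_ord z; lia.
have [|d dz] := ord z.+1; first by have := ltn_ord z; lia.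
have := bond_joins_extremes xX ax bx; have := bond_joins_extremes zX cz dz.
have := @sigma_inj_nat a c; have := @sigma_inj_nat a d.
have := @sigma_inj_nat b c; have := @sigma_inj_nat b d.
lia.
Qed.

Lemma gap_outer (y v : 'I_k.+1) :
  (forall x, x \in X -> y != x.+1 :> nat) ->
  exists p w, lift_perm y v sigma = lift_perm p w sigma /\ outer p || outer w.
Proof.
move=> free; apply/occurs_Box_extension; rewrite coin.
by apply/occurs_Vincular_extension; exists y, v.
Qed.

(** The point inserted between a and b is interior, so the box occurrence
    skips another point; the inserted one then has the role of a or of b, and
    restoring the skipped point raises the value of that entry by 0 or 1. *)
Lemma gap_values (a b : 'I_k) (v : nat) :
  b = a.+1 :> nat -> (forall x, x \in X -> a != x :> nat) -> 0 < v < k ->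
  [|| v == sigma a, v == (sigma a).+1, v == sigma b | v == (sigma b).+1].
Proof.
move=> ab free v0.
have yk : b < k.+1 by have := ltn_ord b; lia.
have vk : v < k.+1 by lia.
have [|p [w [E out]]] := @gap_outer (Ordinal yk) (Ordinal vk).
  by move=> x /free; rewrite /= ab; lia.
have py : p != Ordinal yk.
  apply/eqP => py; have := congr1 (fun s : 'S_k.+1 => val (s p)) E.
  rewrite lift_perm_id {1}py lift_perm_id /= => vw.
  by move: out; rewrite /outer py /= -vw; have := ltn_ord b; lia.
case: (lift_perm_neighbour E py) => -[c [_ cy /= vc]].
  have <- : c = a by apply: val_inj; move: cy; rewrite /=; lia.
  by move: vc; rewrite /bump; lia.
have <- : c = b by apply: val_inj; move: cy; rewrite /=; lia.
by move: vc; rewrite /bump; lia.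
Qed.

End Necessity.

(** * The words of the coincident patterns *)

Lemma lift_permE (k : nat) (sigma : 'S_k) (p w j : 'I_k.+1) :
  lift_perm p w sigma j =
  (if j == p :> nat then w : nat
   else bump w (nth 0 (one_line sigma) (unbump p j)).-1) :> nat.
Proof.
case: (unliftP p j) => [i ->|->]; last by rewrite lift_perm_id eqxx.
rewrite lift_perm_lift /= [bump p i == p]eq_sym (negPf (neq_bump _ _)) bumpK.
by rewrite nth_one_line.
Qed.

(** The inserted point forms with one neighbour a run of two consecutive values, as
    21 in 04213, which no third point prolongs.  Only these two points can be
    deleted to recover sigma, and neither is extreme in position or in value. *)
Lemma no_outer_extension (sigma : 'S_4) (p w : 'I_5) :
  one_line sigma \in
    [:: [:: 1; 4; 2; 3]; [:: 4; 1; 3; 2]; [:: 2; 3; 1; 4]; [:: 3; 2; 4; 1]] ->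
  lift_perm (@Ordinal 5 2 isT) (@Ordinal 5 2 isT) sigma = lift_perm p w sigma ->
  ~~ (outer p || outer w).
Proof.
move=> ow E.
have Ej j (ltj : j < 5) :=
  congr1 (fun s : 'S_5 => nat_of_ord (s (Ordinal ltj))) E.
have := Ej 0 isT; have := Ej 1 isT; have := Ej 2 isT; have := Ej 3 isT; have := Ej 4 isT.
rewrite !lift_permE /outer /unbump; clear E Ej; move: ow.
case: w => w ltw; case: p => -[|[|[|[|[|p]]]]] // ltp.
all: rewrite !inE => /or4P[] /eqP ->; rewrite /= /bump; lia.
Qed.

Lemma word_mkseq (k : nat) (s : 'S_k) : one_line s = mkseq (nth 0 (one_line s)) k.
Proof. by rewrite -{1}(mkseq_nth 0 (one_line s)) size_one_line. Qed.

Section Listed.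

Variables (k : nat) (sigma : 'S_k) (X : {set 'I_k.-1}) (x : 'I_k.-1).
Hypothesis coin : forall n (pi : 'S_n),
  occurs (Box sigma) pi = occurs (Vincular sigma X) pi.
Hypothesis xX : x \in X.
Local Notation s := (nth 0 (one_line sigma)).

Lemma bonds_eq : bonds X = [:: x.+1].
Proof.
rewrite /bonds; have -> : X = [set x].
  by apply/setP => z; rewrite inE (bond_unique coin _ xX).
by rewrite enum_set1.
Qed.

Lemma word_bounds i : i < k -> 0 < s i <= k.
Proof. by move=> lti; rewrite (nth_one_line sigma (Ordinal lti)) /=. Qed.

Lemma word_inj i j : i < k -> j < k -> s i = s j -> i = j.
Proof.
move=> lti ltj; rewrite (nth_one_line sigma (Ordinal lti)) (nth_one_line sigma (Ordinal ltj)).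
by move=> [] /sigma_inj_nat.
Qed.

Lemma word_extremes : (s x = 1 /\ s x.+1 = k) \/ (s x = k /\ s x.+1 = 1).
Proof.
have x1k : x.+1 < k by have := ltn_ord x; lia.
have := bond_joins_extremes coin (a := Ordinal (ltnW x1k)) (b := Ordinal x1k) xX erefl erefl.
rewrite (nth_one_line sigma (Ordinal (ltnW x1k))) (nth_one_line sigma (Ordinal x1k)).
lia.
Qed.

Lemma word_gap c v : c.+1 < k -> c != x -> 0 < v < k ->
  [|| v.+1 == s c, v == s c, v.+1 == s c.+1 | v == s c.+1].
Proof.
move=> ck cx v0.
rewrite (nth_one_line sigma (Ordinal (ltnW ck))) (nth_one_line sigma (Ordinal ck)).
apply: (gap_values coin) => // z; rewrite (bond_unique coin _ xX) => /eqP zx.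
by rewrite zx.
Qed.

(** The gap after the bond is used, or the gap before it when the bond is last.
    Among v = 1, 2, 3, 4, an end of the bond accounts for at most one value and
    the other entry for at most two. *)
Lemma coincident_length_le4 : k <= 4.
Proof.
rewrite leqNgt; apply/negP => k5; have := ltn_ord x; have := word_extremes.
have [xk|xk] := ltnP x.+2 k.
  have g := @word_gap x.+1 _ xk; have := g 1; have := g 2; have := g 3; have := g 4.
  have := word_bounds xk; lia.
have x0 : x.-1.+1 = x by lia.
have := word_gap (c := x.-1); rewrite x0 => g.
have := g 1; have := g 2; have := g 3; have := g 4.
have := @word_bounds x.-1; lia.
Qed.

End Listed.

(** Only these arithmetical conditions on the word s matter in the enumeration of
    the cases k <= 4, once the permutation behind it is forgotten. *)
Lemma word_constraints (k : nat) (sigma : 'S_k) (X : {set 'I_k.-1}) (x : 'I_k.-1) :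
  (forall n (pi : 'S_n), occurs (Box sigma) pi = occurs (Vincular sigma X) pi) ->
  x \in X ->
  exists s : nat -> nat,
    [/\ one_line sigma = mkseq s k, forall i, i < k -> 0 < s i <= k,
        forall i j, i < k -> j < k -> s i = s j -> i = j,
        (s x = 1 /\ s x.+1 = k) \/ (s x = k /\ s x.+1 = 1)
      & forall c v, c.+1 < k -> c != x -> 0 < v < k ->
          [|| v.+1 == s c, v == s c, v.+1 == s c.+1 | v == s c.+1]].
Proof.
move=> coin xX; exists (nth 0 (one_line sigma)); split.
- exact: word_mkseq.
- exact: word_bounds.
- exact: word_inj.
- exact: word_extremes coin xX.
- exact: word_gap coin xX.
Qed.

Lemma listed_of_coincident (k : nat) (sigma : 'S_k) (X : {set 'I_k.-1}) (x : 'I_k.-1) :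
  (forall n (pi : 'S_n), occurs (Box sigma) pi = occurs (Vincular sigma X) pi) ->
  x \in X ->
  (one_line sigma, bonds X) \in listed_patterns.
Proof.
case: k sigma X x => [|[|[|[|[|k]]]]] sigma X x coin xX; try by case: x {xX} => x.
all: have [s [ow bnd inj ext gap]] := word_constraints coin xX.
all: rewrite (bonds_eq coin xX) ow /mkseq /=.
- have x0 : x = 0 :> nat by have := ltn_ord x; lia.
  by move: ext; rewrite x0 => -[] [-> ->].
- have x2 : x = 0 :> nat \/ x = 1 :> nat by have := ltn_ord x; lia.
  have := bnd 2 isT; have := bnd 1 isT; have := bnd 0 isT.
  have := inj 0 1 isT isT; have := inj 0 2 isT isT; have := inj 1 2 isT isT.
  case: x2 ext => -> ext *.
  - by have [[-> [-> ->]]|[-> [-> ->]]] : (s 0 = 1 /\ s 1 = 3 /\ s 2 = 2) \/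
      (s 0 = 3 /\ s 1 = 1 /\ s 2 = 2) by lia.
  - by have [[-> [-> ->]]|[-> [-> ->]]] : (s 0 = 2 /\ s 1 = 1 /\ s 2 = 3) \/
      (s 0 = 2 /\ s 1 = 3 /\ s 2 = 1) by lia.
(* With a bond at either end of a word of length 4, the middle gap is not bonded, so the
   point (2, 2) can be put there. *)
- have rigid : x != 1 :> nat -> one_line sigma \notin
      [:: [:: 1; 4; 2; 3]; [:: 4; 1; 3; 2]; [:: 2; 3; 1; 4]; [:: 3; 2; 4; 1]].
    move=> x1; apply/negP => ws.
    have [|p [w [E out]]] := gap_outer coin (y := @Ordinal 5 2 isT) (@Ordinal 5 2 isT).
      by move=> z; rewrite (bond_unique coin _ xX) => /eqP ->; rewrite eq_sym eqSS.
    by have := no_outer_extension ws E; rewrite out.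
  have ne i j e : s j = e -> i < 4 -> j < 4 -> i != j -> s i != e.
    by move=> <- i4 j4; apply: contraNneq => /(inj i j i4 j4) ->.
  have fourth i e f : i < 4 -> e + f = 5 -> 1 < e < 4 ->
      s i != 1 -> s i != 4 -> s i != f -> s i = e.
    by move/bnd; clear; move: (s i) => u; lia.
  (* Around an unbonded gap, an entry 1 does not account for v = 3, nor an entry 4 for
     v = 1, so the other entry does. *)
  have near c : c < 3 -> c != x ->
      [/\ s c = 1 -> s c.+1 != 4 -> s c.+1 = 3, s c.+1 = 1 -> s c != 4 -> s c = 3,
          s c = 4 -> s c.+1 != 1 -> s c.+1 = 2 & s c.+1 = 4 -> s c != 1 -> s c = 2].
    move=> c3 cx; have := gap c 3 c3 cx isT; have := gap c 1 c3 cx isT.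
    by clear; move: (s c) (s c.+1) => u v *; split; lia.
  move: rigid; rewrite ow /mkseq /=.
  case: (x : nat) (ltn_ord x) ext near => [|[|[|]]] // _ ext near.
  - have [N1 _ N4 _] := near 1 isT isT; move=> /(_ isT); case: ext => -[e0 e1].
      have e2 : s 2 = 2 := N4 e1 (ne 2 0 1 e0 isT isT isT).
      have e3 : s 3 = 3 := fourth 3 3 2 isT erefl isT (ne 3 0 1 e0 isT isT isT)
        (ne 3 1 4 e1 isT isT isT) (ne 3 2 2 e2 isT isT isT).
      by rewrite e0 e1 e2 e3.
    have e2 : s 2 = 3 := N1 e1 (ne 2 0 4 e0 isT isT isT).
    have e3 : s 3 = 2 := fourth 3 2 3 isT erefl isT (ne 3 1 1 e1 isT isT isT)
      (ne 3 0 4 e0 isT isT isT) (ne 3 2 3 e2 isT isT isT).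
    by rewrite e0 e1 e2 e3.
  - have [_ N1 _ N4] := near 0 isT isT; move=> _; case: ext => -[e1 e2].
      have e0 : s 0 = 3 := N1 e1 (ne 0 2 4 e2 isT isT isT).
      have e3 : s 3 = 2 := fourth 3 2 3 isT erefl isT (ne 3 1 1 e1 isT isT isT)
        (ne 3 2 4 e2 isT isT isT) (ne 3 0 3 e0 isT isT isT).
      by rewrite e0 e1 e2 e3.
    have e0 : s 0 = 2 := N4 e1 (ne 0 2 1 e2 isT isT isT).
    have e3 : s 3 = 3 := fourth 3 3 2 isT erefl isT (ne 3 2 1 e2 isT isT isT)
      (ne 3 1 4 e1 isT isT isT) (ne 3 0 2 e0 isT isT isT).
    by rewrite e0 e1 e2 e3.
  - have [_ N1 _ N4] := near 1 isT isT; move=> /(_ isT); case: ext => -[e2 e3].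
      have e1 : s 1 = 3 := N1 e2 (ne 1 3 4 e3 isT isT isT).
      have e0 : s 0 = 2 := fourth 0 2 3 isT erefl isT (ne 0 2 1 e2 isT isT isT)
        (ne 0 3 4 e3 isT isT isT) (ne 0 1 3 e1 isT isT isT).
      by rewrite e0 e1 e2 e3.
    have e1 : s 1 = 2 := N4 e2 (ne 1 3 1 e3 isT isT isT).
    have e0 : s 0 = 3 := fourth 0 3 2 isT erefl isT (ne 0 3 1 e3 isT isT isT)
      (ne 0 2 4 e2 isT isT isT) (ne 0 1 2 e1 isT isT isT).
    by rewrite e0 e1 e2 e3.
- by have := coincident_length_le4 coin xX.
Qed.

(** * The theorem *)

Lemma occurs_Box_self (k : nat) (tau : 'S_k) : occurs (Box tau) tau.
Proof.
apply/existsP; exists [ffun i => i]; apply/box_occurrenceP; split.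
- by apply/increasingP => a b; rewrite !ffunE.
- by apply/order_isomorphicP => a b; rewrite !ffunE.
- by move=> j /negP[]; apply/codomP; exists j; rewrite ffunE.
Qed.

Lemma occurs_Vincular_self (k : nat) (sigma : 'S_k) (X : {set 'I_k.-1}) :
  occurs (Vincular sigma X) sigma.
Proof.
apply/existsP; exists [ffun i => i]; apply/vincular_occurrenceP; split.
- by apply/increasingP => a b; rewrite !ffunE.
- by apply/order_isomorphicP => a b; rewrite !ffunE.
- by move=> x a b _ ax bx; rewrite !ffunE bx ax.
Qed.

Lemma Box_occurs_same_length (k : nat) (sigma tau : 'S_k) :
  occurs (Box tau) sigma -> tau = sigma.
Proof.
case/existsP=> f /box_occurrenceP[/increasingP inc /order_isomorphicP iso _].
apply/permP => i; rewrite -(same_order (g := sigma) (t := tau)) // => a b.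
by rewrite -iso !(increasing_id inc).
Qed.

Lemma coincident_same_length (k m : nat) (sigma : 'S_k) (X : {set 'I_k.-1}) (tau : 'S_m) :
  coincident (Box tau) (Vincular sigma X) -> m = k.
Proof.
move/coincidentP=> coin; apply/eqP; rewrite eqn_leq; apply/andP; split.
  have := occurs_Vincular_self sigma X; rewrite -coin.
  by case/existsP=> f /and3P[/increasing_leq_size].
have := occurs_Box_self tau; rewrite coin.
by case/existsP=> f /and3P[/increasing_leq_size].
Qed.

Theorem theorem5p2 (k m : nat) (sigma : 'S_k) (X : {set 'I_k.-1})
    (tau : 'S_m) (hX : X != set0) :
  (coincident (Box tau) (Vincular sigma X) <->
     (one_line tau, (one_line sigma, bonds X)) \in
       [:: ([:: 1; 2], ([:: 1; 2], [:: 1]));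
           ([:: 2; 1], ([:: 2; 1], [:: 1]));
           ([:: 1; 3; 2], ([:: 1; 3; 2], [:: 1]));
           ([:: 2; 1; 3], ([:: 2; 1; 3], [:: 2]));
           ([:: 2; 3; 1], ([:: 2; 3; 1], [:: 2]));
           ([:: 3; 1; 2], ([:: 3; 1; 2], [:: 1]));
           ([:: 2; 4; 1; 3], ([:: 2; 4; 1; 3], [:: 2]));
           ([:: 3; 1; 4; 2], ([:: 3; 1; 4; 2], [:: 2]))]) /\
  (5 <= k -> ~ coincident (Box tau) (Vincular sigma X)).
Proof.
have [x xX] := set0Pn _ hX.
have same : coincident (Box tau) (Vincular sigma X) ->
    one_line tau = one_line sigma /\ coincident (Box sigma) (Vincular sigma X).
  move=> coin; have mk := coincident_same_length coin; subst m.
  suff E : tau = sigma by rewrite E in coin *.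
  have /coincidentP coin' := coin.
  by apply: Box_occurs_same_length; rewrite coin' occurs_Vincular_self.
split; last first.
  by move=> k5 /same[_ /coincidentP coin]; have := coincident_length_le4 coin xX; lia.
split=> [/same[-> /coincidentP coin]|].
  have := listed_of_coincident coin xX.
  by rewrite /listed_patterns !inE => H; do ?(case/orP: H => H); move/eqP: H => [-> ->].
move=> H.
have [ts L] : one_line tau = one_line sigma /\ (one_line sigma, bonds X) \in listed_patterns.
  by move: H; rewrite !inE => H; do ?(case/orP: H => H); move/eqP: H => [-> -> ->].
have mk : m = k by rewrite -(size_one_line tau) ts size_one_line.
subst m; rewrite (one_line_inj ts); exact: coincident_listed.
Qed.
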